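(* For every $n\ge 1$, assign to each set partition $\sigma$ of $[n]$ the directed graph $D(\sigma)$ with vertex set $[n]$ having an edge from $a$ to $b$ if and only if $a>b$ and $a,b$ lie in different blocks of $\sigma$. Then $\sigma\mapsto D(\sigma)$ induces a bijection between set partitions of $[n]$ and isomorphism classes of DACPs with $n$ vertices. Moreover, a set partition $\sigma$ of $[n]$ contains a set partition $\tau$ of $[k]$ if and only if $D(\sigma)$ has an induced subgraph isomorphic to $D(\tau)$. Consequently, for each set partition $\tau$ of $[k]$, $A_n(\tau)$ equals the number of isomorphism classes of DACPs on $n$ vertices that have no induced subgraph isomorphic to $D(\tau)$.
   Context: For a positive integer $n$, $[n]=\{1,2,\dots,n\}$. A set partition of $[n]$ is a set of pairwise disjoint nonempty subsets of $[n]$ (called blocks) whose union is $[n]$. A set partition $\sigma$ of $[n]$ contains a set partition $\tau$ of $[k]$ if there are elements $x_1<x_2<\cdots<x_k$ of $[n]$ such that for all $i,j\in[k]$, $x_i$ and $x_j$ lie in the same block of $\sigma$ if and only if $i$ and $j$ lie in the same block of $\tau$. Otherwise $\sigma$ avoids $\tau$. $A_n(\tau)$ denotes the number of set partitions of $[n]$ avoiding $\tau$. A complete partite undirected graph on $n$ vertices is a graph whose complement is a union of vertex-disjoint complete graphs (any number of parts is allowed, including one). A directed acyclic complete partite graph (DACP) is a directed acyclic graph whose underlying undirected graph is a complete partite graph (so each adjacent pair of vertices carries exactly one directed edge). *)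

(* Defs.v *)
From mathcomp Require Import all_boot.
Set Implicit Arguments.
Unset Strict Implicit.
Unset Printing Implicit Defensive.

(** The ordered set [n] = {1, ..., n} is represented by
    'I_n = {0, ..., n-1}: only the order of the elements matters. *)

Definition set_partitions (n : nat) : {set {set {set 'I_n}}} :=
  [set sigma | partition sigma [set: 'I_n]].

Definition same_block (V : finType) (P : {set {set V}}) (x y : V) : bool :=
  [exists B in P, (x \in B) && (y \in B)].

Definition contains (n k : nat) (sigma : {set {set 'I_n}})
    (tau : {set {set 'I_k}}) : bool :=
  [exists x : {ffun 'I_k -> 'I_n},
    [forall i : 'I_k, forall j : 'I_k, (i < j) ==> (x i < x j)] &&
    [forall i : 'I_k, forall j : 'I_k,
      same_block sigma (x i) (x j) == same_block tau i j]].

Definition num_avoiding (n k : nat) (tau : {set {set 'I_k}}) : nat :=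
  #|[set sigma in set_partitions n | ~~ contains sigma tau]|.

(** A directed graph on V is its set of edges: (a, b) \in G is an edge from
    a to b. *)
Notation digraph V := {set V * V}.

Definition edge (V : finType) (G : digraph V) : rel V :=
  fun a b => (a, b) \in G.

Definition diso (V W : finType) (G : digraph V) (H : digraph W) : bool :=
  [exists f : {ffun V -> W}, exists g : {ffun W -> V},
    [&& [forall x, g (f x) == x], [forall y, f (g y) == y] &
        [forall a, forall b, edge H (f a) (f b) == edge G a b]]].

Lemma disoP (V W : finType) (G : digraph V) (H : digraph W) :
  reflect (exists2 f : V -> W, bijective f &
             forall a b, edge H (f a) (f b) = edge G a b)
          (diso G H).
Proof.
apply: (iffP existsP) => [[f /existsP[g /and3P[fK gK fE]]]|[f [g fK gK] fE]].
  exists f; first by exists g => z; apply/eqP; [move/forallP: fK | move/forallP: gK].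
  by move=> a b; apply/eqP; move/forallP/(_ a)/forallP: fE.
exists (finfun f); apply/existsP; exists (finfun g).
apply/and3P; split; apply/forallP => z; rewrite ?ffunE ?fK ?gK //.
by apply/forallP => b; rewrite !ffunE fE.
Qed.

(** Every digraph on a finite vertex set is isomorphic to one on 'I_m, so that
    isomorphism classes of digraphs with m vertices can be taken on 'I_m. *)
Lemma diso_ordinal (V : finType) (m : nat) (G : digraph V) :
  #|V| = m -> exists H : digraph 'I_m, diso G H.
Proof.
move=> <-; pose H : digraph 'I_#|V| :=
  [set p | edge G (enum_val p.1) (enum_val p.2)].
exists H; apply/disoP; exists enum_rank.
  by exists enum_val; [exact: enum_rankK | exact: enum_valK].
by move=> a b; rewrite {1}/edge inE /= !enum_rankK.
Qed.

Definition induced (V : finType) (G : digraph V) (S : {set V}) :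
    digraph {x : V | x \in S} :=
  [set p | edge G (val p.1) (val p.2)].

Definition has_induced (V W : finType) (G : digraph V) (H : digraph W) : bool :=
  [exists S : {set V}, diso (induced G S) H].

Definition complement (V : finType) (e : rel V) : rel V :=
  fun x y => (x != y) && ~~ e x y.

Definition disjoint_cliques (V : finType) (e : rel V) : bool :=
  [exists P : {set {set V}}, partition P [set: V] &&
    [forall x, forall y, e x y == (x != y) && same_block P x y]].

Definition complete_partite (V : finType) (e : rel V) : bool :=
  disjoint_cliques (complement e).

Definition underlying (V : finType) (G : digraph V) : rel V :=
  fun x y => (x != y) && (edge G x y || edge G y x).

(** Directed cycles are sequences of distinct vertices, hence of length between
    1 and #|V|; loops and 2-cycles are included. *)
Definition acyclic (V : finType) (G : digraph V) : bool :=
  [forall m : 'I_#|V|, forall c : m.+1.-tuple V, ~~ ucycleb (edge G) c].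

Lemma acyclicP (V : finType) (G : digraph V) :
  reflect (forall c : seq V, c != [::] -> ~ ucycle (edge G) c) (acyclic G).
Proof.
apply: (iffP forallP) => [Gac c c0 cG | Gac m].
  have /andP[_ Uc] := cG.
  have sc : (size c).-1.+1 = size c by rewrite prednK // lt0n size_eq0.
  have lec : (size c).-1 < #|V| by rewrite sc -(card_uniqP Uc) max_card.
  have szc : size c == (Ordinal lec).+1 by rewrite /= sc.
  by move/forallP/(_ (Tuple szc)): (Gac (Ordinal lec)) => /negP[].
apply/forallP => c; apply/negP; apply: Gac.
by rewrite -size_eq0 size_tuple.
Qed.

Definition dacp (V : finType) (G : digraph V) : bool :=
  acyclic G && complete_partite (underlying G).

Definition iso_class (n : nat) (G : digraph 'I_n) : {set digraph 'I_n} :=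
  [set H | diso G H].

Definition dacp_classes (n : nat) : {set {set digraph 'I_n}} :=
  [set iso_class G | G : digraph 'I_n & dacp G].

Definition Dgraph (n : nat) (sigma : {set {set 'I_n}}) : digraph 'I_n :=
  [set p : 'I_n * 'I_n | (p.2 < p.1) && ~~ same_block sigma p.1 p.2].

(* Main.v *)
(** An isomorphism class is recovered from D(sigma) because any embedding of
    D(tau) into D(sigma) can be sorted into an increasing one: only vertices of
    a common block of tau can be out of order, and exchanging their images is
    harmless. An increasing embedding is an occurrence of tau in sigma; when
    both are partitions of [n] it is the identity, so sigma = tau.
    Surjectivity: numbering the vertices of a DACP along a topological order
    turns its partition into parts into a set partition of [n]. *)
Require Import Defs.
From mathcomp Require Import all_boot perm.
From mathcomp Require Import zify.
Set Implicit Arguments.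
Unset Strict Implicit.
Unset Printing Implicit Defensive.

(** * Blocks of a partition as classes of an equivalence relation *)

Section SameBlock.

Variables (V : finType) (P : {set {set V}}).
Hypothesis partP : partition P [set: V].

Lemma same_block_pblock x y : same_block P x y = (y \in pblock P x).
Proof.
have [/eqP covP tiP _] := and3P partP.
apply/existsP/idP => [[B /and3P[PB Bx By]]|yx].
  by rewrite (def_pblock tiP PB Bx).
by exists (pblock P x); rewrite pblock_mem ?mem_pblock ?covP ?inE //=.
Qed.

Lemma same_block_eq_pblock x y :
  same_block P x y = (pblock P x == pblock P y).
Proof.
have [/eqP covP tiP _] := and3P partP.
by rewrite same_block_pblock eq_pblock ?covP ?inE.
Qed.

Lemma same_block_sym x y : same_block P x y = same_block P y x.
Proof. by rewrite !same_block_eq_pblock eq_sym. Qed.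

Lemma same_block_refl x : same_block P x x.
Proof. by rewrite same_block_eq_pblock. Qed.

Lemma same_block_transl x y z :
  same_block P x y -> same_block P x z = same_block P y z.
Proof. by rewrite !same_block_eq_pblock => /eqP->. Qed.

End SameBlock.

(** A partition is recovered as the set of classes of its own relation [same_block]. *)
Lemma eq_same_block (V : finType) (P Q : {set {set V}}) :
  partition P [set: V] -> partition Q [set: V] ->
  same_block P =2 same_block Q -> P = Q.
Proof.
move=> partP partQ eqPQ.
rewrite -(equivalence_partition_pblock partP).
rewrite -(equivalence_partition_pblock partQ).
rewrite /equivalence_partition; apply: eq_imset => x; apply/setP => y.
by rewrite !inE -!same_block_pblock // eqPQ.
Qed.

(** * Isomorphism of digraphs and induced subgraphs *)

Lemma diso_refl (V : finType) (G : digraph V) : diso G G.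
Proof. by apply/disoP; exists id => //; exists id. Qed.

Lemma diso_sym (V W : finType) (G : digraph V) (H : digraph W) :
  diso G H -> diso H G.
Proof.
case/disoP => f [g fK gK] fE; apply/disoP; exists g; first by exists f.
by move=> a b; rewrite -fE !gK.
Qed.

Lemma diso_trans (U V W : finType) (F : digraph U) (G : digraph V)
    (H : digraph W) : diso F G -> diso G H -> diso F H.
Proof.
case/disoP => f bij_f fE /disoP[g bij_g gE]; apply/disoP.
by exists (g \o f) => [|a b]; [exact: bij_comp | rewrite /= gE fE].
Qed.

Lemma iso_class_eq n (G H : digraph 'I_n) :
  (iso_class G == iso_class H) = diso G H.
Proof.
apply/eqP/idP => [/setP/(_ H)|GH].
  by rewrite !inE diso_refl.
apply/setP => K; rewrite !inE; apply/idP/idP; last exact: diso_trans.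
exact/diso_trans/diso_sym.
Qed.

(** Trades the vertex subset for an embedding, which can be composed and rearranged; the subset
    comes back as its image. *)
Lemma has_inducedP (V W : finType) (G : digraph V) (H : digraph W) :
  reflect (exists2 g : W -> V, injective g &
             forall a b, edge G (g a) (g b) = edge H a b)
          (has_induced G H).
Proof.
apply: (iffP existsP) => [[S /diso_sym/disoP[g bij_g gE]]|[g inj_g gE]].
  exists (val \o g) => [|a b]; first exact/inj_comp/bij_inj/bij_g/val_inj.
  by rewrite -gE [RHS]/edge inE.
exists [set g y | y in W]; apply/diso_sym/disoP.
exists (fun y => Sub (g y) (imset_f g (erefl : y \in W))) => [|a b].
  apply: inj_card_bij => [a b /(congr1 val)/inj_g //|].
  by rewrite card_sig card_imset //; apply: subset_leq_card; exact/subsetP.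
by rewrite -gE /edge inE.
Qed.

Lemma has_induced_diso (U V W : finType) (F : digraph U) (G : digraph V)
    (H : digraph W) : diso F G -> has_induced F H = has_induced G H.
Proof.
have mono (A B : finType) (X : digraph A) (Y : digraph B) :
    diso X Y -> has_induced X H -> has_induced Y H.
  case/disoP => f /bij_inj inj_f fE /has_inducedP[g inj_g gE].
  apply/has_inducedP; exists (f \o g) => [|a b]; first exact: inj_comp.
  by rewrite /= fE gE.
by move=> FG; apply/idP/idP; apply: mono => //; exact: diso_sym.
Qed.

(** * Occurrences of [tau] in [sigma] versus embeddings of their digraphs *)

Lemma edge_Dgraph n (sigma : {set {set 'I_n}}) a b :
  edge (Dgraph sigma) a b = (b < a) && ~~ same_block sigma a b.
Proof. by rewrite /edge inE. Qed.

Lemma containsP n k (sigma : {set {set 'I_n}}) (tau : {set {set 'I_k}}) :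
  reflect (exists2 x : 'I_k -> 'I_n, {homo x : i j / i < j} &
             forall i j, same_block sigma (x i) (x j) = same_block tau i j)
          (contains sigma tau).
Proof.
apply: (iffP existsP) => [[x /andP[/'forall_'forall_implyP x_lt]]|[x x_lt xE]].
  by move/'forall_'forall_eqP=> xE; exists x.
exists (finfun x); apply/andP; split.
  by apply/'forall_'forall_implyP => i j; rewrite !ffunE; exact: x_lt.
by apply/'forall_'forall_eqP => i j; rewrite !ffunE.
Qed.

(** Two distinct vertices share a block exactly when no edge joins them in either direction, so an
    embedding respects blocks even where it breaks the order. *)
Lemma Dgraph_embedding_same_block n k (sigma : {set {set 'I_n}})
    (tau : {set {set 'I_k}}) (g : 'I_k -> 'I_n) :
  partition sigma [set: 'I_n] -> partition tau [set: 'I_k] -> injective g ->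
  (forall a b, edge (Dgraph sigma) (g a) (g b) = edge (Dgraph tau) a b) ->
  forall a b, same_block sigma (g a) (g b) = same_block tau a b.
Proof.
move=> sP tP inj_g gE a b.
have [-> | neq_ab] := eqVneq a b; first by rewrite !same_block_refl.
have := gE a b; have := gE b a; rewrite !edge_Dgraph.
rewrite (same_block_sym sP (g b)) (same_block_sym tP b).
have : g a != g b by rewrite (inj_eq inj_g).
move: neq_ab; rewrite -!val_eqE /=.
by do 2 case: ltngtP => _ //=; do 2 case: same_block.
Qed.

Lemma increasing_mono k n (x : 'I_k -> 'I_n) :
  {homo x : i j / i < j} -> {mono x : i j / i < j}.
Proof.
move=> x_lt i j; apply/idP/idP => [|/x_lt //]; rewrite !ltnNge; apply: contra.
by rewrite leq_eqVlt => /orP[/eqP/val_inj->|/x_lt/ltnW].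
Qed.

Lemma increasing_inj k n (x : 'I_k -> 'I_n) :
  {homo x : i j / i < j} -> injective x.
Proof.
move=> /increasing_mono x_mono i j eq_x; apply/val_inj/eqP.
by rewrite /= eqn_leq (leqNgt i) (leqNgt j) -(x_mono j) -(x_mono i) eq_x ltnn.
Qed.

(** Rearrangement inequality: undoing one inversion raises the sum by [(j - i) * (g i - g j)]. The
    sum is the potential that makes sorting by exchanges terminate. *)
Lemma sum_swap_lt k (g : 'I_k -> nat) (i j : 'I_k) :
  i < j -> g j < g i ->
  \sum_(a < k) a * g a < \sum_(a < k) a * g (tperm i j a).
Proof.
move=> lt_ij lt_g.
have neq_ji : j != i by rewrite -val_eqE /= gtn_eqF.
rewrite (bigD1 i) //= (bigD1 j) //=.
rewrite [ltnRHS](bigD1 i) //= [in ltnRHS](bigD1 j) //=.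
rewrite tpermL tpermR.
under [in ltnRHS]eq_bigr => a /andP[ai aj] do rewrite tpermD 1?eq_sym //.
rewrite !addnA ltn_add2r.
by nia.
Qed.

(* If i < j and g j < g i, then i and j share a block of tau, and so does
   everything in between, hence exchanging the values g i and g j gives another
   embedding. *)
Lemma Dgraph_embedding_swap n k (sigma : {set {set 'I_n}})
    (tau : {set {set 'I_k}}) (g : 'I_k -> 'I_n) (i j : 'I_k) :
  partition tau [set: 'I_k] ->
  (forall a b, edge (Dgraph sigma) (g a) (g b) = edge (Dgraph tau) a b) ->
  i < j -> g j < g i ->
  forall a b, edge (Dgraph sigma) (g (tperm i j a)) (g (tperm i j b)) =
    edge (Dgraph tau) a b.
Proof.
move=> tP gE lt_ij lt_g.
(* Elements of different blocks are joined by an edge, so [g] keeps their order. *)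
have g_lt (a b : 'I_k) : b < a -> ~~ same_block tau a b -> g b < g a.
  move=> lt_ba nab; have: edge (Dgraph tau) a b by rewrite edge_Dgraph lt_ba.
  by rewrite -gE edge_Dgraph => /andP[].
have sbij : same_block tau i j.
  apply: contraT => nij; have := g_lt j i lt_ij.
  rewrite same_block_sym // => /(_ nij).
  by rewrite ltnNge ltnW.
(* Otherwise [g i < g c < g j], against the inversion. *)
have between (c : 'I_k) : i < c -> c < j -> same_block tau i c.
  move=> lt_ic lt_cj; apply: contraT => nic.
  have := g_lt c i lt_ic; rewrite (same_block_sym tP) => /(_ nic) lt1.
  have := g_lt j c lt_cj.
  rewrite -(same_block_transl tP c sbij) => /(_ nic) lt2.
  by have := ltn_trans lt_g (ltn_trans lt1 lt2); rewrite ltnn.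
(* Hence an element outside the block of [i] and [j] compares in the same way with both, and the
   exchange cannot be seen from it. *)
have outside (c : 'I_k) : c != i -> c != j -> ~~ same_block tau i c ->
    ((c < i) = (c < j)) * ((i < c) = (j < c)).
  rewrite -!val_eqE /= => ci cj nic.
  have: ~~ (i < c < j) by apply: contra nic => /andP[]; exact: between.
  by split; lia.
have sb_tperm c d : same_block tau (tperm i j c) d = same_block tau c d.
  case: tpermP => [->|->|//]; last exact: same_block_transl.
  by rewrite (same_block_transl tP d sbij).
move=> a b; rewrite gE !edge_Dgraph sb_tperm same_block_sym // sb_tperm.
rewrite same_block_sym //.
have [| nab] := boolP (same_block tau a b); first by rewrite !andbF.
rewrite !andbT; move: nab.
case: (tpermP i j a) => [->|->|/eqP ai /eqP aj];
  case: (tpermP i j b) => [->|->|/eqP bi /eqP bj] //.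
- by rewrite same_block_refl.
- by rewrite sbij.
- by move/(outside _ bi bj) ->.
- by rewrite same_block_sym ?sbij.
- by rewrite same_block_refl.
- by rewrite -(same_block_transl tP b sbij) => /(outside _ bi bj) ->.
- by rewrite same_block_sym // => /(outside _ ai aj) ->.
- rewrite same_block_sym // -(same_block_transl tP a sbij).
  by move/(outside _ ai aj) ->.
Qed.

Lemma contains_has_induced n k (sigma : {set {set 'I_n}})
    (tau : {set {set 'I_k}}) :
  partition sigma [set: 'I_n] -> partition tau [set: 'I_k] ->
  contains sigma tau = has_induced (Dgraph sigma) (Dgraph tau).
Proof.
move=> sP tP; apply/containsP/has_inducedP => [[x x_lt xE]|[g0 inj_g0 g0E]].
  exists x => [|a b]; first exact: increasing_inj.
  by rewrite !edge_Dgraph (increasing_mono x_lt) xE.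
pose embeds (g : {ffun 'I_k -> 'I_n}) := injectiveb g &&
  [forall a, forall b,
    edge (Dgraph sigma) (g a) (g b) == edge (Dgraph tau) a b].
have embeds_g0 : embeds (finfun g0).
  apply/andP; split; first by apply/injectiveP => a b; rewrite !ffunE => /inj_g0.
  by apply/'forall_'forall_eqP => a b; rewrite !ffunE.
(* An embedding of maximal weighted sum has no inversion, since exchanging the two values would give
   another embedding with a larger sum. *)
have [g /andP[/injectiveP inj_g /'forall_'forall_eqP gE] g_max] :=
  arg_maxnP (fun g : {ffun 'I_k -> 'I_n} => \sum_(a < k) a * g a) embeds_g0.
exists g; last exact: Dgraph_embedding_same_block gE.
move=> i j lt_ij; rewrite ltnNge leq_eqVlt; apply/norP; split.
  by apply/negP => /eqP/val_inj/inj_g ji; rewrite ji ltnn in lt_ij.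
apply/negP => lt_g.
suff /g_max : embeds [ffun a => g (tperm i j a)].
  rewrite /= leqNgt => /negP[].
  under [in ltnRHS]eq_bigr do rewrite ffunE.
  exact: (@sum_swap_lt k (fun a => g a)).
apply/andP; split.
  by apply/injectiveP => a b; rewrite !ffunE => /inj_g/perm_inj.
apply/'forall_'forall_eqP => a b; rewrite !ffunE.
exact: Dgraph_embedding_swap.
Qed.

(** * Injectivity: rigidity of increasing self-maps *)

Lemma increasing_leq n (x : 'I_n -> 'I_n) :
  {homo x : i j / i < j} -> forall i : 'I_n, i <= x i.
Proof.
move=> x_lt [m lt_mn] /=; elim: m lt_mn => // m IHm lt_mn.
apply: leq_ltn_trans (IHm (ltnW lt_mn)) _.
exact: (x_lt (Ordinal _) (Ordinal _)).
Qed.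

(** Both [x] and its inverse are increasing, so neither moves a point down. *)
Lemma increasing_ord_id n (x : 'I_n -> 'I_n) :
  {homo x : i j / i < j} -> x =1 id.
Proof.
move=> x_lt.
have [y xK yK] := injF_bij (increasing_inj x_lt).
have y_lt : {homo y : i j / i < j}.
  by move=> i j; rewrite -{1}(yK i) -{1}(yK j) increasing_mono.
move=> i; apply/val_inj/eqP; rewrite /= eqn_leq (increasing_leq x_lt) andbT.
by rewrite -{2}(xK i); exact: increasing_leq.
Qed.

Lemma diso_Dgraph_eq n (sigma tau : {set {set 'I_n}}) :
  partition sigma [set: 'I_n] -> partition tau [set: 'I_n] ->
  diso (Dgraph sigma) (Dgraph tau) -> sigma = tau.
Proof.
move=> sP tP iso_st.
have: contains sigma tau.
  rewrite contains_has_induced // (has_induced_diso _ iso_st).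
  by apply/has_inducedP; exists id.
case/containsP => x /increasing_ord_id x_id xE; apply: eq_same_block => // i j.
by rewrite -xE !x_id.
Qed.

(** * Surjectivity: acyclicity and topological order *)

Lemma acyclic_not_connect (V : finType) (G : digraph V) :
  acyclic G -> forall a b, edge G a b -> ~~ connect (edge G) b a.
Proof.
move/acyclicP => Gac a b ab; apply/negP => /connectP[p bp a_last].
(* A cycle must have distinct vertices, so the return path is made simple before the edge from [a]
   to [b] closes it. *)
case/shortenP: bp a_last => q bq Uq _ a_last.
apply: (Gac (b :: q)) => //; rewrite /ucycle Uq /= rcons_path bq /=.
by rewrite -a_last ab.
Qed.

Lemma topological_sort (V : finType) (G : digraph V) m :
  acyclic G -> #|V| = m ->
  exists2 r : V -> 'I_m, bijective r & forall a b, edge G a b -> r b < r a.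
Proof.
move=> Gac <-.
(* The number of reachable vertices drops strictly along each edge, as [a] itself is lost. Sorting
   by it breaks ties arbitrarily, and the position in the sorted list is the numbering; edges then
   point to smaller numbers, as in [Dgraph]. *)
pose reach a := #|connect (edge G) a|.
have reach_lt a b : edge G a b -> reach b < reach a.
  move=> ab; apply: proper_card; apply/properP; split.
    by apply/subsetP => c; apply: connect_trans; exact: connect1.
  exists a; first exact: connect0.
  exact: acyclic_not_connect ab.
pose s := sort (relpre reach leq) (enum V).
have mem_s a : a \in s by rewrite mem_sort mem_enum.
have size_s : size s = #|V| by rewrite size_sort cardE.
have s_sorted : sorted (relpre reach leq) s.
  by apply: sort_sorted => a b; exact: leq_total.
have lt_index a : index a s < #|V| by rewrite -size_s index_mem.
exists (fun a => Ordinal (lt_index a)) => [|a b /reach_lt].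
  apply: inj_card_bij => [a b [eq_ab]|]; last by rewrite card_ord.
  by rewrite -(nth_index a (mem_s a)) eq_ab nth_index.
rewrite !ltnNge; apply: contra => /= le_ab.
have := sorted_leq_nth _ _ a s_sorted (index a s) (index b s).
rewrite !inE !index_mem !nth_index //=; apply=> //.
- by move=> x y z; exact: leq_trans.
- by move=> x; exact: leqnn.
Qed.

Lemma dacp_Dgraph n (sigma : {set {set 'I_n}}) :
  partition sigma [set: 'I_n] -> dacp (Dgraph sigma).
Proof.
move=> sP; apply/andP; split.
  apply/acyclicP => -[//|a c] _ /andP[/= c_path _].
  (* Edges descend, so by transitivity the start of a closed walk would exceed its last vertex,
     which is [a] again. *)
  have: path (fun x y : 'I_n => y < x) a (rcons c a).
    by apply: sub_path c_path => x y; rewrite edge_Dgraph => /andP[].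
  move/order_path_min => -/(_ _)/allP/(_ a).
  rewrite mem_rcons mem_head ltnn => a_lt.
  by suff: false by []; apply: a_lt => // y x z yx zy; exact: ltn_trans zy yx.
apply/existsP; exists sigma; rewrite sP /=.
apply/'forall_'forall_eqP => x y; rewrite /complement /underlying !edge_Dgraph.
rewrite (same_block_sym sP y) -andb_orl; case: eqVneq => //= neq_xy.
by rewrite -neq_ltn eq_sym val_eqE neq_xy /= negbK.
Qed.

Lemma dacp_diso_Dgraph (V : finType) (G : digraph V) m :
  dacp G -> #|V| = m ->
  exists2 sigma : {set {set 'I_m}}, partition sigma [set: 'I_m] &
    diso G (Dgraph sigma).
Proof.
case/andP => Gac /existsP[P /andP[PP /'forall_'forall_eqP PE]] cardV.
have [r [r' rK r'K] r_lt] := topological_sort Gac cardV.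
(* The parts of the graph, carried over to the numbers of their vertices. *)
pose sigma := preim_partition (fun x => pblock P (r' x)) [set: 'I_m].
have sP : partition sigma [set: 'I_m] by exact: preim_partitionP.
exists sigma => //; apply/disoP; exists r; first by exists r'.
have sE a b : same_block sigma (r a) (r b) = same_block P a b.
  rewrite !same_block_pblock // pblock_equivalence_partition ?inE //; last first.
    by move=> x y z _ _ _; split=> // /eqP->.
  by rewrite !rK -same_block_eq_pblock // same_block_pblock.
move=> a b; rewrite edge_Dgraph sE.
have := PE a b; rewrite /complement /underlying.
have [<- _|neq_ab /=] := eqVneq a b.
  by rewrite ltnn; apply/esym/negP => /r_lt; rewrite ltnn.
(* Vertices in different parts are adjacent, and the numbering decides the direction of their
   edge. *)
move=> <-; rewrite negbK; apply/andP/idP => [[lt_ba /orP[//|/r_lt]]|ab].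
  by rewrite ltnNge ltnW.
by rewrite ab r_lt.
Qed.

Theorem mainTheorem3 (n : nat) (n_gt0 : 0 < n) :
  [/\ forall sigma, sigma \in set_partitions n ->
        iso_class (Dgraph sigma) \in dacp_classes n,
      {in set_partitions n &,
        injective (fun sigma => iso_class (Dgraph sigma))} &
      forall C, C \in dacp_classes n ->
        exists2 sigma, sigma \in set_partitions n & C = iso_class (Dgraph sigma)]
  /\
  (forall (k : nat) (sigma : {set {set 'I_n}}) (tau : {set {set 'I_k}}),
     0 < k -> sigma \in set_partitions n -> tau \in set_partitions k ->
     contains sigma tau <-> has_induced (Dgraph sigma) (Dgraph tau))
  /\
  (forall (k : nat) (tau : {set {set 'I_k}}),
     0 < k -> tau \in set_partitions k ->
     num_avoiding n tau =
     #|[set C in dacp_classes n |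
         [forall G in C, ~~ has_induced G (Dgraph tau)]]|).
Proof.
have partP m (sigma : {set {set 'I_m}}) :
    (sigma \in set_partitions m) = partition sigma [set: 'I_m].
  by rewrite inE.
have class_in sigma : sigma \in set_partitions n ->
    iso_class (Dgraph sigma) \in dacp_classes n.
  by rewrite partP => sP; apply: imset_f; rewrite inE dacp_Dgraph.
have class_inj : {in set_partitions n &,
    injective (fun sigma => iso_class (Dgraph sigma))}.
  move=> sigma tau; rewrite !partP => sP tP /eqP.
  by rewrite iso_class_eq; exact: diso_Dgraph_eq.
have class_surj C : C \in dacp_classes n ->
    exists2 sigma, sigma \in set_partitions n & C = iso_class (Dgraph sigma).
  case/imsetP => G; rewrite inE => Gd ->.
  have [sigma sP Gs] := dacp_diso_Dgraph Gd (card_ord n).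
  by exists sigma; [rewrite partP | apply/eqP; rewrite iso_class_eq].
split=> //; split=> [k sigma tau _|k tau _]; rewrite !partP.
  by move=> sP tP; rewrite contains_has_induced.
move=> tP; rewrite /num_avoiding.
(* Having an induced copy of [Dgraph tau] is invariant under isomorphism, so testing a whole class
   amounts to testing its member [Dgraph sigma]. *)
have avoidE sigma : sigma \in set_partitions n ->
    [forall G in iso_class (Dgraph sigma), ~~ has_induced G (Dgraph tau)] =
    ~~ contains sigma tau.
  rewrite partP => sP; rewrite contains_has_induced //.
  apply/'forall_implyP/idP => [/(_ (Dgraph sigma))|ns G].
    by rewrite inE diso_refl; exact.
  by rewrite inE => /has_induced_diso <-.
(* The bijection restricts to avoiding partitions, whose image is the set of avoiding classes. *)
rewrite -(card_in_imset (f := fun sigma => iso_class (Dgraph sigma))).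
  apply: eq_card => C; rewrite [RHS]inE; apply/imsetP/andP.
    case=> sigma; rewrite inE => /andP[sP ns] ->.
    by rewrite class_in // avoidE.
  case=> /class_surj[sigma sP ->]; rewrite avoidE // => ns.
  by exists sigma; rewrite // inE sP.
move=> sigma1 sigma2; rewrite !inE => /andP[s1 _] /andP[s2 _].
by apply: class_inj; rewrite inE.
Qed.
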